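(* Let $k,s\ge 1$ be integers and let $r\in\{1,\ldots,k\}$. For $n\ge 0$ let $f_{n,k}$ denote the total number of occurrences of $r\times s$ rectangles over all words of length $n$ over the alphabet $\{1,\ldots,k\}$, and let $F_k(x)=\sum_{n\ge 0}f_{n,k}x^n$. Then $$F_k(x)=\frac{x^s\sum_{j=1}^{k-r+1}j^s}{(1-kx)^{2}}.$$ Thus, for $n\geq s$, $$f_{n,k}=(n-s+1)k^{n-s}\sum_{j=1}^{k-r+1}j^s.$$
   Context: For a word $w=w_1\cdots w_n$ of positive integers, its bargraph consists of $n$ consecutive columns of unit cells, aligned at the bottom, the $i$-th column having height $w_i$. An occurrence of an $r\times s$ rectangle in $w$ is a placement of a rectangle of height $r$ and width $s$ (with sides along the unit grid) inside the bargraph. Equivalently, the number of occurrences is $\sum_{i=1}^{n-s+1}\max\{\min\{w_i,\ldots,w_{i+s-1}\}-r+1,0\}$ (which is $0$ if $n<s$). The total number over a set of words is the sum of these numbers over all words in the set. *)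

(* Defs.v *)
From HB Require Import structures.
From mathcomp Require Import all_boot all_order all_algebra.
From mathcomp Require Import boolp.

Set Implicit Arguments.
Unset Strict Implicit.
Unset Printing Implicit Defensive.

Import GRing.Theory.

(** The cell [(c, h)] has lower left corner [(c, h)], so that columns and rows
    are numbered from 0; the letter [w_(c+1)] of the usual 1-based indexing is
    [nth 0 w c]. *)
Definition in_bargraph (w : seq nat) (c h : nat) : bool :=
  (c < size w) && (h < nth 0 w c).

Definition rect_in (r s : nat) (w : seq nat) (c h : nat) : bool :=
  [forall a : 'I_s, forall b : 'I_r, in_bargraph w (c + a) (h + b)].

(** A placement is recorded by its lower left cell. For [r, s >= 1] that cell
    belongs to the bargraph, so it suffices to search a box containing the
    bargraph. *)
Definition occ (r s : nat) (w : seq nat) : nat :=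
  #|[set p : 'I_(size w) * 'I_(\max_(a <- w) a) | rect_in r s w p.1 p.2]|.

(** [min(w_(i+1), ..., w_(i+s))] for [s >= 1]. *)
Definition window_min (s : nat) (w : seq nat) (i : nat) : nat :=
  \big[minn/nth 0 w i]_(j < s) nth 0 w (i + j).

Lemma leq_window_min s w i m : 0 < s ->
  (m <= window_min s w i) = [forall j : 'I_s, m <= nth 0 w (i + j)].
Proof.
rewrite /window_min => s0.
have {1}-> : nth 0 w i = nth 0 w (i + Ordinal s0) by rewrite addn0.
set F := fun j : 'I_s => nth 0 w (i + j).
apply/idP/forallP => [+ j|mF]; last first.
  by elim/big_ind: _ => [|x y mx my|j _]; rewrite ?leq_min ?mx ?my //; apply: mF.
have : j \in index_enum 'I_s by rewrite mem_index_enum.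
elim: (index_enum _) => // x t IH; rewrite big_cons leq_min => /[swap].
by move=> /andP[Fx Ft]; rewrite inE => /predU1P[->|/IH]; last exact.
Qed.

Lemma rect_inE r s w c h : 0 < r -> 0 < s ->
  rect_in r s w c h = (c + s <= size w) && (h + r <= window_min s w c).
Proof.
move=> r0 s0; rewrite leq_window_min //.
have rP : r.-1 < r by rewrite prednK.
have sP : s.-1 < s by rewrite prednK.
apply/forallP/andP => [H|[cs /forallP H] a].
  split.
    have /forallP/(_ (Ordinal rP)) /andP[+ _] := H (Ordinal sP).
    by rewrite /= -addnS prednK.
  apply/forallP => a; have /forallP/(_ (Ordinal rP)) /andP[_] := H a.
  by rewrite /= -addnS prednK.
apply/forallP => b; apply/andP; split.
  by rewrite (leq_trans _ cs) // ltn_add2l.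
by rewrite (leq_trans _ (H a)) // ltn_add2l.
Qed.

(** The truncated subtraction realises [max(min(..) - r + 1, 0)], and the range
    of [i] is empty when [size w < s]. *)
Lemma occE r s w : 0 < r -> 0 < s ->
  occ r s w =
  \sum_(i < (size w).+1 - s) ((window_min s w i).+1 - r).
Proof.
move=> r0 s0; rewrite /occ -sum1_card; set M := \max_(a <- w) a.
rewrite (eq_bigl (fun p : 'I_(size w) * 'I_M => (true && true) &&
    ((p.1 + s <= size w) && (p.2 + r <= window_min s w p.1)))); last first.
  by move=> p; rewrite inE rect_inE.
rewrite -(pair_big_dep xpredT (fun (i : 'I_(size w)) (h : 'I_M) =>
    (i + s <= size w) && (h + r <= window_min s w i)) (fun _ _ => 1)) /=.
have le : (size w).+1 - s <= size w by rewrite leq_subLR -add1n leq_add2r.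
rewrite [RHS](big_ord_widen _ (fun i => ((window_min s w i).+1 - r)) le).
rewrite [RHS]big_mkcond /=; apply: eq_bigr => i _.
have -> : (i < (size w).+1 - s) = (i + s <= size w).
  by rewrite ltn_subRL addnC ltnS.
case: leqP => /= [ile|_]; last by rewrite big_pred0.
set m := window_min s w i.
have mM : m <= M.
  rewrite /m /M (leq_trans (n := nth 0 w i)) //.
    have : m <= m by []. rewrite {2}/m leq_window_min // => /forallP /(_ (Ordinal s0)).
    by rewrite addn0.
  by rewrite (big_nth 0) big_mkord (leq_bigmax_cond (F := fun j : 'I__ => nth 0 w j)).
have le2 : m.+1 - r <= M by rewrite (leq_trans _ mM) // leq_subLR -add1n leq_add2r.
transitivity (\sum_(h < m.+1 - r) 1); last by rewrite sum1_card card_ord.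
rewrite [RHS](big_ord_widen _ (fun=> 1) le2); apply: eq_bigl => h.
by rewrite ltn_subRL addnC ltnS.
Qed.

(** ['I_k.+1] is [{0, ..., k}]; dropping the letter 0 leaves the alphabet
    [{1, ..., k}], with each letter being its own height. *)
Definition is_word (k n : nat) (w : n.-tuple 'I_k.+1) : bool :=
  all (fun a : 'I_k.+1 => 0 < a) w.

Definition total_occ (r s n k : nat) : nat :=
  \sum_(w : n.-tuple 'I_k.+1 | is_word w) occ r s (map val w).

Local Open Scope ring_scope.

Record fps (R : Type) := Fps { fcoef : nat -> R }.

Lemma fpsP R (a b : fps R) : fcoef a =1 fcoef b -> a = b.
Proof. by case: a b => [a] [b] /= /funext ->. Qed.

HB.instance Definition _ R := gen_eqMixin (fps R).
HB.instance Definition _ R := gen_choiceMixin (fps R).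

Section FpsZmod.
Variable R : zmodType.
Implicit Types a b c : fps R.

Definition fps_zero : fps R := Fps (fun=> 0).
Definition fps_opp a : fps R := Fps (fun n => - fcoef a n).
Definition fps_add a b : fps R := Fps (fun n => fcoef a n + fcoef b n).

Fact fps_addA : associative fps_add.
Proof. by move=> a b c; apply: fpsP => n /=; rewrite addrA. Qed.
Fact fps_addC : commutative fps_add.
Proof. by move=> a b; apply: fpsP => n /=; rewrite addrC. Qed.
Fact fps_add0 : left_id fps_zero fps_add.
Proof. by move=> a; apply: fpsP => n /=; rewrite add0r. Qed.
Fact fps_addN : left_inverse fps_zero fps_opp fps_add.
Proof. by move=> a; apply: fpsP => n /=; rewrite addNr. Qed.

HB.instance Definition _ :=
  GRing.isZmodule.Build (fps R) fps_addA fps_addC fps_add0 fps_addN.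

Lemma fcoef0 n : fcoef (0 : fps R) n = 0. Proof. by []. Qed.
Lemma fcoefD a b n : fcoef (a + b) n = fcoef a n + fcoef b n.
Proof. by []. Qed.
Lemma fcoefN a n : fcoef (- a) n = - fcoef a n. Proof. by []. Qed.
Lemma fcoefB a b n : fcoef (a - b) n = fcoef a n - fcoef b n.
Proof. by []. Qed.
Lemma fcoefMn a m n : fcoef (a *+ m) n = fcoef a n *+ m.
Proof. by elim: m => // m IH; rewrite !mulrS fcoefD IH. Qed.
Lemma fcoef_sum I (t : seq I) (P : pred I) (F : I -> fps R) n :
  fcoef (\sum_(i <- t | P i) F i) n = \sum_(i <- t | P i) fcoef (F i) n.
Proof. by elim/big_rec2: _ => // i x y _ <-. Qed.
End FpsZmod.

Section FpsRing.
Variable R : comNzRingType.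
Implicit Types a b c : fps R.

Definition fps_one : fps R := Fps (fun n => (n == 0%N)%:R).
Definition fps_mul a b : fps R :=
  Fps (fun n => \sum_(i < n.+1) fcoef a i * fcoef b (n - i)).

Let trunc m a : {poly R} := \poly_(i < m) fcoef a i.

Let trunc_mul m a b n : (n < m)%N ->
  fcoef (fps_mul a b) n = (trunc m a * trunc m b)`_n.
Proof.
move=> nm; rewrite coefM /=; apply: eq_bigr => i _; rewrite !coef_poly.
have -> : (i < m)%N by rewrite (leq_ltn_trans _ nm) // -ltnS.
by have -> : (n - i < m)%N by rewrite (leq_ltn_trans _ nm) ?leq_subr.
Qed.

Fact fps_mulC : commutative fps_mul.
Proof.
by move=> a b; apply: fpsP => n; rewrite !(trunc_mul _ _ (ltnSn n)) mulrC.
Qed.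

Let trunc_mul3 a b c n :
  fcoef (fps_mul (fps_mul a b) c) n
  = (trunc n.+1 a * trunc n.+1 b * trunc n.+1 c)`_n.
Proof.
rewrite coefM; apply: eq_bigr => i _.
by rewrite (trunc_mul _ _ (ltn_ord i)) coef_poly ltnS leq_subr.
Qed.

Fact fps_mulA : associative fps_mul.
Proof.
move=> a b c; apply: fpsP => n.
by rewrite fps_mulC !trunc_mul3 mulrC mulrA.
Qed.

Fact fps_mul1 : left_id fps_one fps_mul.
Proof.
move=> a; apply: fpsP => n /=; rewrite big_ord_recl /= mul1r subn0 big1 ?addr0 //.
by move=> i _; rewrite mul0r.
Qed.

Fact fps_mulDl : left_distributive fps_mul +%R.
Proof.
move=> a b c; apply: fpsP => n /=; rewrite -big_split /=.
by apply: eq_bigr => i _; rewrite mulrDl.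
Qed.

Fact fps_one_neq0 : fps_one != 0.
Proof.
by apply/eqP => /(congr1 (fun a => fcoef a 0)) /eqP; rewrite /= oner_eq0.
Qed.

HB.instance Definition _ := GRing.Zmodule_isComNzRing.Build (fps R)
  fps_mulA fps_mulC fps_mul1 fps_mulDl fps_one_neq0.

Lemma fcoef1 n : fcoef (1 : fps R) n = (n == 0%N)%:R. Proof. by []. Qed.
Lemma fcoefM a b n :
  fcoef (a * b) n = \sum_(i < n.+1) fcoef a i * fcoef b (n - i).
Proof. by []. Qed.
Lemma fcoefM0 a b : fcoef (a * b) 0 = fcoef a 0 * fcoef b 0.
Proof. by rewrite fcoefM big_ord1. Qed.
Lemma fcoef_nat m n : fcoef (m%:R : fps R) n = m%:R *+ (n == 0%N).
Proof. by rewrite fcoefMn fcoef1; case: eqP; rewrite ?mul0rn. Qed.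

Definition fpsC (x : R) : fps R := Fps (fun n => x *+ (n == 0%N)).
Definition fpsX : fps R := Fps (fun n => (n == 1%N)%:R).

Lemma fcoefCM x a n : fcoef (fpsC x * a) n = x * fcoef a n.
Proof.
rewrite fcoefM big_ord_recl subn0 big1 ?addr0 // => i _.
by rewrite /= mul0r.
Qed.

Lemma fcoefXM a n :
  fcoef (fpsX * a) n = if n is m.+1 then fcoef a m else 0.
Proof.
case: n => [|n]; first by rewrite fcoefM0 mul0r.
rewrite fcoefM big_ord_recl mul0r add0r big_ord_recl mul1r subSS subn0.
by rewrite big1 ?addr0 // => i _; rewrite mul0r.
Qed.

Lemma fcoefXnM m a n :
  fcoef (fpsX ^+ m * a) n = if (n < m)%N then 0 else fcoef a (n - m).
Proof.
elim: m n => [|m IH] n; first by rewrite mul1r subn0.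
by rewrite exprS -mulrA fcoefXM; case: n => [|n] //; rewrite IH ltnS subSS.
Qed.

Lemma fcoef_exp_lt (u : fps R) i n :
  fcoef u 0 = 0 -> (n < i)%N -> fcoef (u ^+ i) n = 0.
Proof.
move=> u0; elim: i n => // i IH n ni; rewrite exprS fcoefM big1 // => j _.
case: (posnP j) => [->|j0]; first by rewrite u0 mul0r.
rewrite IH ?mulr0 // ltn_subLR; last by rewrite -ltnS.
by rewrite (leq_trans ni) // -add1n leq_add2r.
Qed.
End FpsRing.

Arguments fpsX {R}.

Section FpsUnit.
Variable R : comUnitRingType.
Implicit Types a b : fps R.

Definition fps_unit : {pred fps R} := fun a => fcoef a 0 \is a GRing.unit.

(** [a = a_0 (1 - u)] with [u] of zero constant term, so that
    [a^-1 = a_0^-1 (1 + u + u^2 + ...)]. *)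
Definition fps_inv a : fps R :=
  let u := 1 - fpsC (fcoef a 0)^-1 * a in
  if a \in fps_unit then
    Fps (fun n => (fcoef a 0)^-1 * fcoef (\sum_(i < n.+1) u ^+ i) n)
  else a.

Fact fps_mulV : {in fps_unit, left_inverse 1 fps_inv *%R}.
Proof.
move=> a ua; rewrite /fps_inv ua; set u := 1 - _; set x := (fcoef a 0)^-1.
have u0 : fcoef u 0 = 0 by rewrite fcoefB fcoefCM mulVr ?subrr.
apply: fpsP => n.
pose S := \sum_(i < n.+1) u ^+ i.
transitivity (fcoef (S * (fpsC x * a)) n).
  rewrite mulrCA fcoefCM !fcoefM mulr_sumr; apply: eq_bigr => i _.
  rewrite mulrA; congr (_ * _ * _); rewrite /S !fcoef_sum.
  rewrite (big_ord_widen _ (fun j => fcoef (u ^+ j) i) (ltn_ord i)).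
  rewrite big_mkcond /=; apply: eq_bigr => j _.
  by case: ltnP => // ij; rewrite fcoef_exp_lt.
have -> : fpsC x * a = 1 - u by rewrite opprB addrC subrK.
have -> : S * (1 - u) = 1 - u ^+ n.+1.
  by rewrite -[RHS]opprB subrX1 -/S -[1 - u]opprB mulrN mulrC.
by rewrite fcoefB fcoef_exp_lt ?subr0.
Qed.

Fact fps_unitPl a b : b * a = 1 -> fps_unit a.
Proof.
move=> /(congr1 (fun c => fcoef c 0)); rewrite fcoefM0 => h.
by apply/unitrPr; exists (fcoef b 0); rewrite mulrC.
Qed.

Fact fps_inv_out : {in [predC fps_unit], fps_inv =1 id}.
Proof. by move=> a; rewrite /fps_inv inE /= => /negbTE ->. Qed.

HB.instance Definition _ := GRing.ComNzRing_hasMulInverse.Build (fps R)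
  fps_mulV fps_unitPl fps_inv_out.

Lemma fps_unitE a : (a \is a GRing.unit) = (fcoef a 0 \is a GRing.unit).
Proof. by []. Qed.
End FpsUnit.

(** [sum_(n >= 0) f_(n,k) x^n] *)
Definition gen_series (r s k : nat) : fps rat :=
  Fps (fun n => (total_occ r s n k)%:R).

(* Main.v *)
Require Import Defs.
From mathcomp Require Import all_boot all_order all_algebra.
From mathcomp Require Import zify.

Import GRing.Theory.

(** The number of [r x s] rectangles with left column [i] is the number of
    heights [h >= r] such that the [s] letters from position [i] on are all at
    least [h]: the rectangle whose top edge is at height [h] fits exactly then.
    Exchanging the sums, [f_(n,k)] is a sum over the [n - s + 1] positions [i]
    and the heights [r <= h <= k] of the number of words whose letters in the
    window [i, ..., i + s - 1] are at least [h]. The letters of such a word are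
    chosen independently, [k + 1 - h] ways inside the window and [k] ways
    outside ([card_window_ge]), so that the count does not depend on [i] and is
    [(k + 1 - h)^s k^(n - s)]. Writing [j = k + 1 - h] gives the closed formula
    [total_occE].

    The generating function is then [x^s (\sum_j j^s) \sum_m (m + 1) k^m x^m],
    and the last series is the inverse of [(1 - k x)^2] ([fps_geom_sqr]), being
    the square of the geometric series of [k x]. *)

(** * Counting words with large letters in a window *)

(** A tuple whose entries satisfy independent constraints is chosen entry by
    entry, which is the distributivity of product over sum. *)
Lemma card_tuple_family (T : finType) n (A : 'I_n -> pred T) :
  #|[pred w : n.-tuple T | [forall p, A p (tnth w p)]]| = \prod_(p < n) #|A p|.
Proof.
pose tup (f : {ffun 'I_n -> T}) : n.-tuple T := [tuple f p | p < n].
pose fn (w : n.-tuple T) : {ffun 'I_n -> T} := [ffun p => tnth w p].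
have tupK : cancel tup fn by move=> f; apply/ffunP=> p; rewrite ffunE tnth_mktuple.
have fnK : cancel fn tup.
  by move=> w; apply: eq_from_tnth => p; rewrite tnth_mktuple ffunE.
rewrite -sum1_card (reindex tup) /=; last by exists fn => w _.
transitivity #|family A|; last by rewrite card_family foldrE big_map enumT.
rewrite -sum1_card; apply: eq_bigl => f; rewrite !inE.
by apply: eq_forallb => p; rewrite tnth_mktuple.
Qed.

Lemma card_ord_ge k h : #|[pred a : 'I_k.+1 | h <= a]| = k.+1 - h.
Proof.
(* The minimum covers [h > k.+1], where no letter is counted. *)
have := cardC [pred a : 'I_k.+1 | a < minn h k.+1].
rewrite -[X in X + _]sum1_card -(big_ord_widen _ (fun=> 1)) ?geq_minr //.
rewrite sum1_card !card_ord => /(canRL (addKn _)).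
have -> : k.+1 - minn h k.+1 = k.+1 - h by lia.
by move=> <-; apply: eq_card => a; rewrite !inE /=; have := ltn_ord a; lia.
Qed.

Lemma prod_window n s i a b : i + s <= n ->
  \prod_(p < n) (if i <= p < i + s then a else b) = a ^ s * b ^ (n - s).
Proof.
move=> isn; rewrite -(big_mkord xpredT (fun p => if i <= p < i + s then a else b)).
rewrite (@big_cat_nat _ _ _ i) //=; last by lia.
rewrite (@big_cat_nat _ _ _ (i + s) i) //=; last by lia.
rewrite (eq_big_nat _ _ (F2 := fun=> b)); last by move=> p; case: ifP; lia.
rewrite [X in _ * (X * _)](eq_big_nat _ _ (F2 := fun=> a)); last first.
  by move=> p; case: ifP; lia.
rewrite [X in _ * (_ * X)](eq_big_nat _ _ (F2 := fun=> b)); last first.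
  by move=> p; case: ifP; lia.
rewrite !prod_nat_const_nat subn0 addKn mulnCA -expnD.
by congr (_ * _ ^ _); lia.
Qed.

(** The positivity of the letters is the constraint [1 <= a] outside the
    window; inside, it follows from [h <= a]. *)
Lemma card_window_ge k n s i h : 0 < s -> 0 < h -> i + s <= n ->
  #|[pred w : n.-tuple 'I_k.+1 |
      is_word w && (h <= window_min s (map val w) i)]|
  = (k.+1 - h) ^ s * k ^ (n - s).
Proof.
move=> s0 h0 isn; rewrite -(prod_window _ _ _ _ _ isn).
pose t (p : 'I_n) := if i <= p < i + s then h else 1.
pose A (p : 'I_n) := [pred a : 'I_k.+1 | t p <= a].
transitivity (\prod_(p < n) #|A p|); last first.
  apply: eq_bigr => p _; rewrite card_ord_ge /t.
  by case: ifP => // _; rewrite subSS subn0.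
rewrite -card_tuple_family; apply: eq_card => w; rewrite !inE leq_window_min //.
have nthE p (pn : p < n) : nth 0 (map val w) p = tnth w (Ordinal pn).
  by rewrite (tnth_nth ord0) (nth_map ord0) ?size_tuple.
apply/andP/forallP => [[/all_tnthP pos /forallP win] p | H].
  rewrite /= /t; case: ifP => [/andP[ip pis]|_]; last exact: pos.
  have jP : p - i < s by lia.
  have := win (Ordinal jP); rewrite /= subnKC // nthE.
  by congr (_ <= tnth w _); apply: val_inj.
split; first by apply/all_tnthP=> p; have := H p; rewrite /= /t; case: ifP; lia.
apply/forallP=> j; have jn : i + j < n by have := ltn_ord j; lia.
have := H (Ordinal jn); rewrite nthE /= /t /=.
by case: ifP => //; have := ltn_ord j; lia.
Qed.

(** * The closed formula *)

(** Turns the truncated count of rectangles in a column range, which is not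
    multiplicative in the letters, into a sum of threshold events, each of which
    is a product of independent conditions on the letters. *)
Lemma sum_ge_threshold r k m : m <= k ->
  m.+1 - r = \sum_(r <= h < k.+1) (h <= m).
Proof.
move=> mk; case: (leqP r m.+1) => rm; last first.
  rewrite big_nat big1; first by lia.
  by move=> h /andP[rh _]; case: leqP => //; lia.
rewrite (@big_cat_nat _ _ _ m.+1) //=.
rewrite (eq_big_nat _ _ (F2 := fun=> 1)); last by move=> h; case: leqP; lia.
rewrite [X in _ + X](eq_big_nat _ _ (F2 := fun=> 0)); last first.
  by move=> h; case: leqP; lia.
by rewrite !sum_nat_const_nat; lia.
Qed.

Lemma window_min_le k n s i (w : n.-tuple 'I_k.+1) : 0 < s ->
  window_min s (map val w) i <= k.
Proof.
move=> s0; apply: (@leq_trans (nth 0 (map val w) i)).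
  have := leqnn (window_min s (map val w) i); rewrite leq_window_min //.
  by move/forallP/(_ (Ordinal s0)); rewrite addn0.
(* Past the end of the word the default letter is 0. *)
case: (ltnP i n) => ni; last by rewrite nth_default ?size_map ?size_tuple.
by rewrite (nth_map ord0) ?size_tuple // -ltnS ltn_ord.
Qed.

(** The factor is [n.+1 - s] rather than [n - s + 1] so that the formula also
    covers [n < s], where it vanishes; the generating function needs all [n]. *)
Lemma total_occE r s n k : 0 < r <= k -> 0 < s ->
  total_occ r s n k
  = (n.+1 - s) * k ^ (n - s) * \sum_(1 <= j < (k - r + 1).+1) j ^ s.
Proof.
move=> /andP[r0 rk] s0.
transitivity (\sum_(i < n.+1 - s) \sum_(r <= h < k.+1)
    (k.+1 - h) ^ s * k ^ (n - s)).
  transitivity (\sum_(w : n.-tuple 'I_k.+1 | is_word w) \sum_(i < n.+1 - s)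
      \sum_(r <= h < k.+1) (h <= window_min s (map val w) i)).
    apply: eq_bigr => w _; rewrite occE // size_map size_tuple.
    by apply: eq_bigr => i _; apply/sum_ge_threshold/window_min_le.
  rewrite exchange_big; apply: eq_bigr => i _.
  rewrite exchange_big big_nat [RHS]big_nat; apply: eq_bigr => h /andP[rh hk].
  rewrite -(card_window_ge k n s i h) //; first last.
  - by have := ltn_ord i; lia.
  - by lia.
  by rewrite -sum1_card big_mkcondr.
rewrite sum_nat_const card_ord -big_distrl /= -mulnA; congr (_ * _).
rewrite mulnC; congr (_ * _).
(* Reversing [r <= h <= k] and shifting it to start at 1 turns [h] into
   [k + 1 - h]. *)
rewrite big_nat_rev /= -{1}(prednK r0) -add1n big_addn.
have -> : k.+1 - r.-1 = (k - r + 1).+1 by lia.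
by apply: eq_big_nat => j jk; congr (_ ^ _); lia.
Qed.

(** * The generating function *)

Local Open Scope ring_scope.

Section Geometric.

Variables (R : comNzRingType) (k : nat).

Lemma fcoef_mul_1BnX (a : fps R) n :
  fcoef (a * (1 - k%:R * fpsX)) n
  = fcoef a n - (if n is m.+1 then fcoef a m else 0) *+ k.
Proof.
by rewrite mulrC mulrBl mul1r fcoefB -mulrA mulr_natl fcoefMn fcoefXM.
Qed.

(** Multiplying by [1 - k x] once turns [\sum_n (n + 1) k^n x^n] into
    [\sum_n k^n x^n], since [(n + 1) k^n - k (n k^(n - 1)) = k^n], and a second
    time into [1]. *)
Lemma fps_geom_sqr :
  Fps (fun n => (n.+1 * k ^ n)%N%:R : R) * (1 - k%:R * fpsX) ^+ 2 = 1.
Proof.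
have step1 : Fps (fun n => (n.+1 * k ^ n)%N%:R : R) * (1 - k%:R * fpsX)
    = Fps (fun n => (k ^ n)%N%:R).
  apply: fpsP => -[|n]; rewrite fcoef_mul_1BnX /= ?mul0rn ?subr0 //.
  have -> : (n.+2 * k ^ n.+1 = k ^ n.+1 + n.+1 * k ^ n * k)%N.
    by rewrite expnSr; nia.
  by rewrite natrD mulrnA addrK.
rewrite expr2 mulrA step1; apply: fpsP => -[|n].
  by rewrite fcoef_mul_1BnX /= mul0rn subr0.
by rewrite fcoef_mul_1BnX /= -mulrnA expnS mulnC subrr.
Qed.

End Geometric.

Theorem theorem6 (k s r : nat) (hk : (1 <= k)%N) (hs : (1 <= s)%N)
    (hr : (1 <= r <= k)%N) :
  gen_series r s k
    = fpsX ^+ s * (\sum_(1 <= j < (k - r + 1).+1) j%:R ^+ s)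
      / (1 - k%:R * fpsX) ^+ 2
  /\ (forall n : nat, (s <= n)%N ->
        total_occ r s n k
          = ((n - s + 1) * k ^ (n - s)
               * \sum_(1 <= j < (k - r + 1).+1) j ^ s)%N).
Proof.
split=> [|n sn]; last by rewrite total_occE // subSn // (addn1 (n - s)).
have geom := fps_geom_sqr rat k.
have unit_den : (1 - k%:R * fpsX : fps rat) ^+ 2 \is a GRing.unit.
  by apply/unitrPr; exists (Fps (fun n => (n.+1 * k ^ n)%N%:R)); rewrite mulrC.
apply: (canRL (mulrK unit_den)).
under eq_bigr do rewrite -natrX.
rewrite -natr_sum; set S := (\sum_(1 <= j < _) _)%N.
transitivity (fpsX ^+ s * S%:R * Fps (fun n => (n.+1 * k ^ n)%N%:R : rat)
              * (1 - k%:R * fpsX) ^+ 2); last by rewrite -mulrA geom mulr1.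
congr (_ * _); apply: fpsP => n.
rewrite -mulrA fcoefXnM mulr_natl fcoefMn /= total_occE // -/S.
case: ltnP => [ns|sn]; first by have -> : (n.+1 - s = 0)%N by lia.
by rewrite -mulrnA subSn.
Qed.
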